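(* Let $G$ be a finite simple graph with $n$ vertices and $m$ edges. If $G$ has a DET:OLD set, then $m \ge \left\lceil \frac{3n - \lfloor n/2\rfloor}{2}\right\rceil$.
   Context: For a graph $G$ and $v\in V(G)$, $N(v)$ is the open neighborhood of $v$. For $S\subseteq V(G)$ write $N_S(v)=N(v)\cap S$. A set $S\subseteq V(G)$ is a DET:OLD set of $G$ if (1) every vertex $v\in V(G)$ satisfies $|N_S(v)|\ge 2$, and (2) every pair of distinct vertices $u,v\in V(G)$ satisfies $|N_S(u)\setminus N_S(v)|\ge 2$ or $|N_S(v)\setminus N_S(u)|\ge 2$. ''$G$ has a DET:OLD set'' means some $S\subseteq V(G)$ is a DET:OLD set of $G$. *)

(* Defs.v *)
From mathcomp Require Import all_boot.

Set Implicit Arguments.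
Unset Strict Implicit.
Unset Printing Implicit Defensive.

(* A finite simple graph is an adjacency relation [e : rel T] on a finite type
   of vertices, assumed symmetric and irreflexive where it is used. *)

Definition edges (T : finType) (e : rel T) : {set {set T}} :=
  [set [set x; y] | x in T, y in e x].

Definition open_nbhd (T : finType) (e : rel T) (v : T) : {set T} :=
  [set w | e v w].

Definition nbhd_in (T : finType) (e : rel T) (S : {set T}) (v : T) : {set T} :=
  open_nbhd e v :&: S.

Definition det_old (T : finType) (e : rel T) (S : {set T}) : Prop :=
  (forall v : T, 2 <= #|nbhd_in e S v|) /\
  (forall u v : T, u <> v ->
     2 <= #|nbhd_in e S u :\: nbhd_in e S v| \/
     2 <= #|nbhd_in e S v :\: nbhd_in e S u|).

Definition has_det_old (T : finType) (e : rel T) : Prop :=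
  exists S : {set T}, det_old e S.

(* For the bound: [k./2] is the floor of k/2 and [uphalf k] is its ceiling. In
   [3 * n - n./2] the truncated subtraction is exact, since n./2 <= 3 * n. *)

(* Main.v *)
Require Import Defs.
From mathcomp Require Import all_boot.
From mathcomp Require Import zify.

Set Implicit Arguments.
Unset Strict Implicit.

(** Two distinct vertices of degree 2 cannot share a neighbor: all neighbors of
    a vertex of degree 2 lie in the DET:OLD set, so a common one would leave at
    most one vertex in either difference. Hence the neighborhoods of the
    vertices of degree 2 are disjoint, at most n/2 vertices have degree 2, all
    others have degree at least 3, and the degree sum gives the bound. *)

(** Double counting: both sides count the pairs in [r] with [P i] and [Q j]. *)
Lemma sum_card_rel (I J : finType) (P : pred I) (Q : pred J) (r : I -> J -> bool) :
  \sum_(i | P i) #|[set j | Q j & r i j]| = \sum_(j | Q j) #|[set i | P i & r i j]|.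
Proof.
transitivity (\sum_(i | P i) \sum_(j | Q j) r i j).
  apply: eq_bigr => i _; rewrite -sum1dep_card big_mkcondr /=.
  by apply: eq_bigr => j _; case: (r i j).
rewrite exchange_big /=; apply: eq_bigr => j _; rewrite -sum1dep_card big_mkcondr /=.
by apply: eq_bigr => i _; case: (r i j).
Qed.

Lemma set2_injr (T : finType) (x : T) : injective (fun y => [set x; y]).
Proof.
move=> y z /= eq_xyz; have := set22 x z; rewrite -eq_xyz => /set2P[z_x|//].
by have := set22 x y; rewrite eq_xyz z_x => /set2P[].
Qed.

(** The map sending [y] to [[set x; y]] injects the neighbors of [x] into the edges containing [x],
    and an edge contains at most two vertices. *)
Lemma sum_degree_le (T : finType) (e : rel T) :
  \sum_x #|open_nbhd e x| <= 2 * #|edges e|.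
Proof.
have degree_le x : #|open_nbhd e x| <= #|[set E | E \in edges e & x \in E]|.
  rewrite -(card_imset _ (@set2_injr T x)); apply/subset_leq_card/subsetP => E.
  case/imsetP=> y; rewrite inE => exy ->.
  by rewrite inE set21 andbT; apply/imset2P; exists x y.
apply: (@leq_trans (\sum_x #|[set E | E \in edges e & x \in E]|)).
  by apply: leq_sum => x _; apply: degree_le.
rewrite (sum_card_rel predT (mem (edges e)) (fun x E => x \in E)) mulnC -sum_nat_const.
apply: leq_sum => E /imset2P[x y _ _ ->].
rewrite (_ : [set _ | _ & _] = [set x; y]); first by rewrite cards2; case: (_ != _).
by apply/setP=> z; rewrite !inE.
Qed.

Section DetOld.

Variables (T : finType) (e : rel T) (S : {set T}).
Hypothesis S_det_old : det_old e S.

Lemma det_old_degree_ge2 (v : T) : 2 <= #|open_nbhd e v|.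
Proof. by apply: leq_trans (S_det_old.1 v) (subset_leq_card (subsetIl _ _)). Qed.

Lemma det_old_nbhd_in_degree2 (v : T) :
  #|open_nbhd e v| = 2 -> nbhd_in e S v = open_nbhd e v.
Proof.
by move=> deg_v; apply/eqP; rewrite eqEcard subsetIl deg_v S_det_old.1.
Qed.

Lemma det_old_degree2_disjoint (u v w : T) :
  #|open_nbhd e u| = 2 -> #|open_nbhd e v| = 2 -> e u w -> e v w -> u = v.
Proof.
have diff_le1 a b : #|open_nbhd e a| = 2 -> e a w -> e b w ->
    #|open_nbhd e a :\: open_nbhd e b| <= 1.
  move=> deg_a ea eb; have a_w : w \in open_nbhd e a by rewrite inE.
  (* The bound 1 becomes the size of [open_nbhd e a :\ w], which contains the difference since [w]
     is also a neighbor of [b]. *)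
  have := cardsD1 w (open_nbhd e a); rewrite a_w deg_a => -[->].
  by apply/subset_leq_card/setDS; rewrite sub1set inE.
move=> deg_u deg_v eu ev; apply/eqP/negPn/negP => /eqP neq_uv.
have := S_det_old.2 u v neq_uv; rewrite !det_old_nbhd_in_degree2 //.
by case; rewrite leqNgt ltnS diff_le1.
Qed.

(** Count pairs of a vertex of degree 2 and a neighbor [w] of it: each such vertex gives two pairs,
    and each [w] occurs at most once by disjointness. *)
Lemma det_old_card_degree2 : 2 * #|[set v | #|open_nbhd e v| == 2]| <= #|T|.
Proof.
rewrite mulnC -sum_nat_const.
under eq_bigl do rewrite inE.
(* Each summand 2 is turned back into a degree, written in the form that [sum_card_rel] expects. *)
under eq_bigr => v /eqP <- do
  rewrite -[open_nbhd e v]/[set w | predT w & e v w].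
rewrite sum_card_rel -sum1_card; apply: leq_sum => w _.
apply/card_le1_eqP => u v; rewrite !inE => /andP[/eqP deg_u eu] /andP[/eqP deg_v ev].
exact: det_old_degree2_disjoint deg_v deg_u ev eu.
Qed.

(** Holds vertex by vertex: a degree is at least 3, or it is 2 and the indicator of degree 2
    supplies the missing 1. *)
Lemma det_old_sum_degree :
  3 * #|T| <= \sum_v #|open_nbhd e v| + #|[set v | #|open_nbhd e v| == 2]|.
Proof.
rewrite (_ : 3 * #|T| = \sum_(v : T) 3); last by rewrite sum_nat_const mulnC.
rewrite -sum1dep_card [X in _ + X]big_mkcond -big_split /=; apply: leq_sum => v _.
by have := det_old_degree_ge2 v; case: #|_| => [|[|[|k]]].
Qed.

End DetOld.

Theorem theorem4 (T : finType) (e : rel T)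
    (e_sym : symmetric e) (e_irr : irreflexive e) (n m : nat)
    (n_def : n = #|T|) (m_def : m = #|edges e|)
    (e_det_old : has_det_old e) :
  uphalf (3 * n - n./2) <= m.
Proof.
case: e_det_old => S S_det_old.
have := det_old_card_degree2 S_det_old.
have := det_old_sum_degree S_det_old.
have := sum_degree_le e.
(* With [k] vertices of degree 2, [k <= n./2] and [3 * n <= 2 * m + k]; halving
   [3 * n - n./2 <= 2 * m] rounds up as [m] is an integer. *)
rewrite -n_def -m_def; lia.
Qed.
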